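(* Let $m\ge 1$ and let $G=G_1\times\cdots\times G_m$, where each $G_i$ is either some $\Gamma_n$ or some finite index subgroup $H$ of some $\Gamma_n$ (with $n\ge 2$ allowed to depend on $i$). Then $G$ has property $R_\infty$.
   Context: For an integer $n\ge 2$ with prime decomposition $n=p_1^{y_1}\cdots p_r^{y_r}$ (the $p_i$ pairwise distinct primes, $y_i\ge 1$), $$\Gamma_n=\langle a,t_1,\dots,t_r\mid t_it_j=t_jt_i\ (i\ne j),\ t_iat_i^{-1}=a^{p_i^{y_i}}\ (i=1,\dots,r)\rangle.$$ A group $G$ has property $R_\infty$ if for every $\varphi\in\mathrm{Aut}(G)$ the number $R(\varphi)$ of equivalence classes of the relation on $G$ given by $g\sim h\iff zg\varphi(z)^{-1}=h$ for some $z\in G$ is infinite. *)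

(* Defs.v *)
From HB Require Import structures.
From mathcomp Require Import all_boot.
From mathcomp Require Import boolp classical_sets cardinality.

Set Implicit Arguments.
Unset Strict Implicit.
Unset Printing Implicit Defensive.

Local Open Scope quotient_scope.
Local Open Scope group_scope.

(* A word is a product of letters: [(x, false)] stands for the generator [x]
   and [(x, true)] for its formal inverse. *)
Definition word (X : choiceType) := seq (X * bool).

Definition winv (X : choiceType) (w : word X) : word X :=
  rev [seq (l.1, ~~ l.2) | l <- w].

(* The least congruence containing free cancellation and [rel u v] (read as
   the relation "u = v"). *)
Inductive word_eq (X : choiceType) (rel : word X -> word X -> Prop) :
    word X -> word X -> Prop :=
| WordRefl u : word_eq rel u u
| WordSym u v : word_eq rel u v -> word_eq rel v u
| WordTrans v u w : word_eq rel u v -> word_eq rel v w -> word_eq rel u w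
| WordCat u u' v v' :
    word_eq rel u u' -> word_eq rel v v' -> word_eq rel (u ++ v) (u' ++ v')
| WordCancel x b : word_eq rel [:: (x, b); (x, ~~ b)] [::]
| WordRel u v : rel u v -> word_eq rel u v.

Section Presentation.
Variables (X : choiceType) (rel : word X -> word X -> Prop).

Definition word_eqb (u v : word X) : bool := `[< word_eq rel u v >].

Fact word_eqb_refl : reflexive word_eqb.
Proof. by move=> u; apply/asboolP/WordRefl. Qed.

Fact word_eqb_sym : symmetric word_eqb.
Proof. by move=> u v; apply/asboolP/asboolP => /WordSym. Qed.

Fact word_eqb_trans : transitive word_eqb.
Proof.
by move=> v u w /asboolP uv /asboolP vw; apply/asboolP/(WordTrans uv vw).
Qed.

Definition word_equiv : equiv_rel (word X) :=
  EquivRel word_eqb word_eqb_refl word_eqb_sym word_eqb_trans.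

Definition presented := {eq_quot word_equiv}.

HB.instance Definition _ := Choice.copy presented {eq_quot word_equiv}.

Definition pword (w : word X) : presented := \pi_{eq_quot word_equiv} w.
Definition pgen (x : X) : presented := pword [:: (x, false)].

Fact pwordP u v : pword u = pword v <-> word_eq rel u v.
Proof.
split; first by move=> /eqmodP /asboolP.
by move=> uv; apply/eqmodP/asboolP.
Qed.

Fact pword_repr (x : presented) : pword (repr x) = x.
Proof. exact: reprK. Qed.

Fact word_inv_left w : word_eq rel (winv w ++ w) [::].
Proof.
elim: w => [|[x b] w IHw]; first exact: WordRefl.
rewrite /winv /= rev_cons -cats1 -catA /=.
apply: WordTrans IHw; apply: WordCat (WordRefl _ _) _.
have := WordCancel rel x (~~ b); rewrite negbK => xK.
exact: WordCat xK (WordRefl _ w).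
Qed.

Fact winvK : involutive (@winv X).
Proof.
move=> w; rewrite /winv map_rev revK -map_comp -[RHS]map_id.
by apply: eq_map => -[x b] /=; rewrite negbK.
Qed.

Fact word_inv_right w : word_eq rel (w ++ winv w) [::].
Proof. by have := word_inv_left (winv w); rewrite winvK. Qed.

Fact word_eq_inv u v : word_eq rel u v -> word_eq rel (winv u) (winv v).
Proof.
move=> uv; apply: (WordTrans (v := winv u ++ (v ++ winv v))).
  rewrite -[X in word_eq _ X _]cats0.
  exact: WordCat (WordRefl _ _) (WordSym (word_inv_right v)).
rewrite catA -[X in word_eq _ _ X]cat0s.
apply: WordCat (WordRefl _ _); apply: WordTrans (word_inv_left u).
exact: WordCat (WordRefl _ _) (WordSym uv).
Qed.

Definition pmul (x y : presented) : presented := pword (repr x ++ repr y).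
Definition pone : presented := pword [::].
Definition pinv (x : presented) : presented := pword (winv (repr x)).

Fact word_eq_repr w : word_eq rel (repr (pword w)) w.
Proof. by apply/pwordP; rewrite pword_repr. Qed.

Fact pwordM u v : pword (u ++ v) = pmul (pword u) (pword v).
Proof. by apply/pwordP/WordSym/WordCat; apply: word_eq_repr. Qed.

Fact pwordV u : pword (winv u) = pinv (pword u).
Proof. by apply/pwordP/WordSym/word_eq_inv/word_eq_repr. Qed.

Fact pmulA : associative pmul.
Proof.
move=> x y z; rewrite -[x]pword_repr -[y]pword_repr -[z]pword_repr.
by rewrite -!pwordM catA.
Qed.

Fact pmul1 : left_id pone pmul.
Proof. by move=> x; rewrite -[x]pword_repr -pwordM. Qed.

Fact pmulr1 : right_id pone pmul.
Proof. by move=> x; rewrite -[x]pword_repr -pwordM cats0. Qed.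

Fact pmulV : left_inverse pone pinv pmul.
Proof.
move=> x; rewrite -[x]pword_repr -pwordV -pwordM.
exact/pwordP/word_inv_left.
Qed.

Fact pmulrV : right_inverse pone pinv pmul.
Proof.
move=> x; rewrite -[x]pword_repr -pwordV -pwordM.
exact/pwordP/word_inv_right.
Qed.

HB.instance Definition _ :=
  isGroup.Build presented pmulA pmul1 pmulr1 pmulV pmulrV.

End Presentation.

Definition subgroup (G : groupType) (H : groupClosed G) := {x : G | x \in H}.

Section Subgroup.
Variables (G : groupType) (H : groupClosed G).

Fact subgroup_closed : group_closed H.
Proof.
by split=> [|x y xH yH]; [exact: gpred1|exact: gpredM xH (gpredVr y yH)].
Qed.

HB.instance Definition _ := [isSub of subgroup H for @sval G _].
HB.instance Definition _ := [Choice of subgroup H by <:].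
HB.instance Definition _ :=
  SubChoice_isSubGroup.Build G (fun x => x \in H) (subgroup H) subgroup_closed.

End Subgroup.

Definition finite_index (G : groupType) (H : groupClosed G) : Prop :=
  finite_set (range (fun g : G => [set g * h | h in [set` H]]%classic)).

Definition prodgroup (I : Type) (G : I -> groupType) := forall i, G i.

Section DirectProduct.
Variables (I : Type) (G : I -> groupType).

HB.instance Definition _ := gen_eqMixin (prodgroup G).
HB.instance Definition _ := gen_choiceMixin (prodgroup G).

Definition prod_mul (f g : prodgroup G) : prodgroup G := fun i => f i * g i.
Definition prod_one : prodgroup G := fun i => 1.
Definition prod_inv (f : prodgroup G) : prodgroup G := fun i => (f i)^-1.

Fact prod_mulA : associative prod_mul.
Proof. by move=> f g h; apply: functional_extensionality_dep => i; exact: mulgA. Qed.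

Fact prod_mul1 : left_id prod_one prod_mul.
Proof. by move=> f; apply: functional_extensionality_dep => i; exact: mul1g. Qed.

Fact prod_mulr1 : right_id prod_one prod_mul.
Proof. by move=> f; apply: functional_extensionality_dep => i; exact: mulg1. Qed.

Fact prod_mulV : left_inverse prod_one prod_inv prod_mul.
Proof. by move=> f; apply: functional_extensionality_dep => i; exact: mulVg. Qed.

Fact prod_mulrV : right_inverse prod_one prod_inv prod_mul.
Proof. by move=> f; apply: functional_extensionality_dep => i; exact: mulgV. Qed.

HB.instance Definition _ :=
  isGroup.Build (prodgroup G) prod_mulA prod_mul1 prod_mulr1 prod_mulV prod_mulrV.

End DirectProduct.

Definition isomorphic (G H : groupType) : Prop :=
  exists f : {multiplicative G -> H}, bijective f.

(* The distinct primes p_1, ..., p_r are listed by [primes n], and y_i is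
   [logn p_i n]. *)
Definition Gamma_rank (n : nat) : nat := size (primes n).

Definition Gamma_exp (n : nat) (i : 'I_(Gamma_rank n)) : nat :=
  let p := nth 0%N (primes n) i in (p ^ logn p n)%N.

(* [None] is the generator a, and [Some i] the generator t_i. *)
Definition Gamma_gen (n : nat) : choiceType := option 'I_(Gamma_rank n).

Inductive Gamma_rel (n : nat) : word (Gamma_gen n) -> word (Gamma_gen n) -> Prop :=
| Gamma_comm (i j : 'I_(Gamma_rank n)) : i != j ->
    Gamma_rel [:: (Some i, false); (Some j, false)]
              [:: (Some j, false); (Some i, false)]
| Gamma_conj (i : 'I_(Gamma_rank n)) :
    Gamma_rel [:: (Some i, false); (None, false); (Some i, true)]
              (nseq (Gamma_exp i) (None, false)).

Definition Gamma (n : nat) : groupType := presented (@Gamma_rel n).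

Definition twisted_class (G : groupType) (phi : G -> G) (g : G) : set G :=
  [set h | exists z, z * g * (phi z)^-1 = h]%classic.

Definition Rinfty (G : groupType) : Prop :=
  forall phi : {multiplicative G -> G}, bijective phi ->
    infinite_set (range (twisted_class phi)).

(* Main.v *)
Require Import Defs.
From HB Require Import structures.
From mathcomp Require Import all_boot.
From mathcomp Require Import all_order all_algebra ring.
From mathcomp Require Import boolp classical_sets cardinality.

Set Implicit Arguments.
Unset Strict Implicit.
Unset Printing Implicit Defensive.

Import Order.TTheory GRing.Theory Num.Theory.

(** Let a group act on the rational line by the affine maps x |-> q * x + b with
    q > 0, as Gamma_n does when a acts as x |-> x + 1 and t_i as
    x |-> p_i ^ y_i * x.  This action of Gamma_n is faithful: every element can
    be written T^-1 * a^z * T', where T and T' are products of the t_i and z is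
    an integer, and unique factorization recovers T = T' and z = 0 from a
    trivial action (Gamma_faithful).  A faithful affine action restricts to
    finite index subgroups, and there it still contains a nontrivial translation
    and a map with scale q <> 1, because powers of the original ones survive
    (affine_rep_finite_index).  From here on, only such actions matter
    (affine_rep).

    Let G be a product of m >= 1 groups with such actions, and let N be the
    subgroup of the elements that act as a translation in every coordinate.
    - N consists of the elements that commute with all their conjugates
      (pureP).  So every automorphism phi preserves N.
    - The translation lengths embed N in rat^m with an image of full rank, so phi
      acts on N as an invertible rational matrix B (shifts_aut, aut_mx_unit).
    - Conjugation by g acts on N as the diagonal matrix D(g) of the scales of g,
      and applying phi to g * x * g^-1 gives B * D(phi g) = D(g) * B.
      Hence det D(phi g) = det D(g) (total_scale_aut).

    The homomorphism g |-> det D(g) to the positive rationals is therefore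
    invariant under phi, so z * g * (phi z)^-1 and g have the same image: it
    is constant on twisted conjugacy classes.  Its values on the powers of an
    element that has a single scale q <> 1 are distinct, so there are infinitely
    many classes (Rinfty_product). *)

(** * Affine actions on the rational line *)

Section AffineRep.
Local Open Scope ring_scope.

(** A faithful action by the maps [x |-> scale g * x + shift g], with two witnesses
    that exclude the degenerate cases: [translation] gives the group a nonzero
    vector to act on, and [dilation] gives it infinitely many scales. *)
Record affine_rep (G : groupType) := AffineRep {
  scale : G -> rat;
  shift : G -> rat;
  scaleM : forall g h, scale (g * h)%g = scale g * scale h;
  shiftM : forall g h, shift (g * h)%g = shift g + scale g * shift h;
  scale_gt0 : forall g, 0 < scale g;
  rep_eq1 : forall g, scale g = 1 -> shift g = 0 -> g = 1%g;
  translation : G;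
  scale_translation : scale translation = 1;
  shift_translation : shift translation != 0;
  dilation : G;
  scale_dilation : scale dilation != 1
}.

Variables (G : groupType) (r : affine_rep G).

Lemma scale_neq0 g : scale r g != 0.
Proof. by rewrite lt0r_neq0 // scale_gt0. Qed.

Lemma scale1 : scale r 1%g = 1.
Proof. by apply: (mulfI (scale_neq0 1%g)); rewrite -scaleM mulg1 mulr1. Qed.

Lemma shift1 : shift r 1%g = 0.
Proof.
have := shiftM r 1%g 1%g; rewrite mulg1 scale1 mul1r => /eqP.
by rewrite -subr_eq0 opprD addNKr oppr_eq0 => /eqP.
Qed.

Lemma scaleV g : scale r g^-1%g = (scale r g)^-1.
Proof.
by apply: (mulfI (scale_neq0 g)); rewrite -scaleM mulgV scale1 divff ?scale_neq0.
Qed.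

Lemma shiftV g : shift r g^-1%g = - ((scale r g)^-1 * shift r g).
Proof.
have := shiftM r g^-1%g g; rewrite mulVg shift1 scaleV => /esym/eqP.
by rewrite addr_eq0 => /eqP.
Qed.

Lemma scaleX g k : scale r (g ^+ k)%g = scale r g ^+ k.
Proof.
by elim: k => [|k IHk]; rewrite ?expg0 ?scale1 // expgS scaleM IHk exprS.
Qed.

Lemma shiftX g k : scale r g = 1 -> shift r (g ^+ k)%g = k%:R * shift r g.
Proof.
move=> g1; elim: k => [|k IHk]; first by rewrite expg0 shift1 mul0r.
by rewrite expgS shiftM g1 IHk mul1r -{1}[shift r g]mul1r -mulrDl mulrS.
Qed.

Lemma shift_conj g h : scale r h = 1 ->
  shift r (g * h * g^-1)%g = scale r g * shift r h.
Proof.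
move=> h1; rewrite !shiftM !scaleM h1 shiftV.
by field; rewrite scale_neq0.
Qed.

Lemma rep_inj g h : scale r g = scale r h -> shift r g = shift r h -> g = h.
Proof.
move=> e1 e2; apply: divg1_eq; apply: (rep_eq1 (a := r)).
  by rewrite scaleM scaleV e1 divff ?scale_neq0.
by rewrite shiftM shiftV e1 e2 mulrN mulVKf ?subrr ?scale_neq0.
Qed.

(** If [a] is a translation by [s] and [g] has scale [q], the two products of [g] and
    its conjugate by [a] differ by a translation of [(1 - q) ^+ 2 * s]. *)
Lemma commute_conj_translation g :
  commute g (translation r * g * (translation r)^-1)%g -> scale r g = 1.
Proof.
set a := translation r => cg.
have a1 : scale r a = 1 := scale_translation r.
have: shift r (g * (a * g * a^-1))%g = shift r (a * g * a^-1 * g)%g.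
  by rewrite cg.
rewrite !(shiftM, scaleM, shiftV, scaleV) a1 => e.
apply/eqP/negPn/negP => g1.
have: (1 - scale r g) ^+ 2 * shift r a = 0.
  move: e; rewrite !invr1 !mul1r !mulr1 => /esym/eqP; rewrite -subr_eq0.
  by move=> /eqP e; rewrite -[RHS]e; ring.
move/eqP; rewrite mulf_eq0 (negPf (shift_translation r)) orbF expf_eq0 /=.
by rewrite subr_eq0 eq_sym (negPf g1).
Qed.

End AffineRep.

(** * Finite index subgroups and isomorphic groups *)

Lemma infinite_of_seq (T : Type) (A : set T) (u : nat -> T) :
  injective u -> (forall k, A (u k)) -> infinite_set A.
Proof.
move=> inju uA finA; apply: infinite_nat.
have -> : [set: nat]%classic = (u @^-1` A)%classic.
  by apply/seteqP; split=> // k _; apply: uA.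
by apply: finite_preimage => // x y _ _; apply: inju.
Qed.

Section Transport.
Local Open Scope ring_scope.

Lemma affine_rep_comp (G H : groupType) (f : G -> H) (r : affine_rep H) a d :
  injective f -> {morph f : x y / (x * y)%g} ->
  scale r (f a) = 1 -> shift r (f a) != 0 -> scale r (f d) != 1 ->
  affine_rep G.
Proof.
move=> injf fM fa1 fa0 fd1.
have f1 : f 1%g = 1%g.
  by apply: (@mulgI _ (f 1%g)); rewrite -fM !mulg1.
apply: (@AffineRep G (scale r \o f) (shift r \o f) _ _ _ _ a fa1 fa0 d fd1) => /=.
- by move=> g h; rewrite fM scaleM.
- by move=> g h; rewrite fM shiftM.
- by move=> g; apply: scale_gt0.
- by move=> g g1 g0; apply: injf; rewrite f1; apply: rep_eq1 g1 g0.
Qed.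

Lemma affine_rep_isomorphic (G H : groupType) :
  isomorphic G H -> affine_rep H -> inhabited (affine_rep G).
Proof.
case=> f [f' fK f'K] r.
by constructor; apply: (@affine_rep_comp _ _ f r (f' (translation r))
    (f' (dilation r)) (can_inj fK) (@gmulfM _ _ f)); rewrite f'K;
  [apply: scale_translation|apply: shift_translation|apply: scale_dilation].
Qed.

(** Two of the cosets of the powers of [g] coincide. *)
Lemma finite_index_expg (G : groupType) (H : groupClosed G) (g : G) :
  finite_index H -> exists2 k, (0 < k)%N & (g ^+ k)%g \in H.
Proof.
move=> finH; apply: contrapT => noX.
pose coset (x : G) := [set (x * h)%g | h in [set` H]]%classic.
apply: (@infinite_of_seq _ _ (fun k => coset (g ^+ k)%g)) finH; last first.
  by move=> k; exists (g ^+ k)%g.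
suff ltn_coset j k : (j < k)%N -> coset (g ^+ j)%g <> coset (g ^+ k)%g.
  move=> j k e; case: (ltngtP j k) => // jk; first by case: (ltn_coset _ _ jk).
  by case: (ltn_coset _ _ jk).
move=> jk e; have : coset (g ^+ j)%g (g ^+ k)%g.
  by rewrite e; exists 1%g; rewrite /= ?mulg1 ?gpred1.
case=> h /= hH gk; apply: noX; exists (k - j)%N; first by rewrite subn_gt0.
suff <- : h = (g ^+ (k - j))%g by [].
by apply: (@mulgI _ (g ^+ j)%g); rewrite gk -expgnDr subnKC // ltnW.
Qed.

Lemma affine_rep_finite_index (G : groupType) (H : groupClosed G) :
  finite_index H -> affine_rep G -> inhabited (affine_rep (subgroup H)).
Proof.
move=> finH r.
have [k k0 aH] := finite_index_expg (translation r) finH.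
have [l l0 dH] := finite_index_expg (dilation r) finH.
have a1 := scale_translation r.
pose a : subgroup H := exist (fun x => x \in H) _ aH.
pose d : subgroup H := exist (fun x => x \in H) _ dH.
constructor; refine (@affine_rep_comp (subgroup H) G val r a d _ _ _ _ _) => /=.
- exact: val_inj.
- by move=> x y.
- by rewrite scaleX a1 expr1n.
- by rewrite shiftX // mulf_neq0 ?shift_translation // pnatr_eq0 -lt0n.
- by rewrite scaleX pexpr_eq1 ?scale_dilation // ltW ?scale_gt0.
Qed.

End Transport.

(** * The affine action of Gamma_n *)

Section GammaRep.
Variable n : nat.

Local Notation letter := (Gamma_gen n * bool)%type.

Section AffineAction.
Local Open Scope ring_scope.

(** The pair [(q, b)] encodes the map [x |-> q * x + b]. *)
Definition aff_comp (x y : rat * rat) : rat * rat := (x.1 * y.1, x.2 + x.1 * y.2).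

Definition aff_letter (l : letter) : rat * rat :=
  match l with
  | (None, b) => (1, (-1) ^+ b)
  | (Some i, b) => let q := (Gamma_exp i)%:R in (if b then q^-1 else q, 0)
  end.

Definition aff_word (w : word (Gamma_gen n)) : rat * rat :=
  foldr (fun l => aff_comp (aff_letter l)) (1, 0) w.

Lemma Gamma_exp_gt0 (i : 'I_(Gamma_rank n)) : (0 < Gamma_exp i)%N.
Proof.
rewrite /Gamma_exp expn_gt0; have := mem_nth 0%N (ltn_ord i).
by rewrite mem_primes => /and3P[/prime_gt0 ->].
Qed.

Lemma Gamma_exp_neq0 (i : 'I_(Gamma_rank n)) : (Gamma_exp i)%:R != 0 :> rat.
Proof. by rewrite pnatr_eq0 -lt0n Gamma_exp_gt0. Qed.

Lemma aff_word_cat u v : aff_word (u ++ v) = aff_comp (aff_word u) (aff_word v).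
Proof.
elim: u => [|l u /= ->]; rewrite /aff_comp /=.
  by rewrite !mul1r add0r; case: (aff_word v).
by congr (_, _); ring.
Qed.

Lemma aff_word_nseq k : aff_word (nseq k (None, false)) = (1, k%:R).
Proof. by elim: k => //= k ->; rewrite /aff_comp /= !mul1r expr0 mulrS. Qed.

Lemma aff_word_eq u v : word_eq (@Gamma_rel n) u v -> aff_word u = aff_word v.
Proof.
elim=> // {u v}.
- by move=> v u w _ -> _ ->.
- by move=> u u' v v' _ eu _ ev; rewrite !aff_word_cat eu ev.
- move=> [i|] b; rewrite /aff_word /= /aff_comp /=.
    by case: b => /=; rewrite ?mulr1 ?mulr0 ?addr0 ?divff ?mulVf ?Gamma_exp_neq0.
  by case: b => /=; rewrite ?(mulr1, mul1r, mulr0, addr0, expr0, expr1, subrr, addNr).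
- move=> u v [i j _|i]; rewrite ?aff_word_nseq /aff_word /= /aff_comp /=.
    by rewrite !(mulr0, addr0, mulr1) mulrC.
  by rewrite !(mul1r, mulr1, mulr0, addr0, add0r, expr0) divff ?Gamma_exp_neq0.
Qed.

Lemma aff_repr w : aff_word (repr (pword (@Gamma_rel n) w)) = aff_word w.
Proof. exact/aff_word_eq/word_eq_repr. Qed.

Lemma aff_reprM (g h : Gamma n) :
  aff_word (repr (g * h)%g) = aff_comp (aff_word (repr g)) (aff_word (repr h)).
Proof. by rewrite aff_repr aff_word_cat. Qed.

Lemma aff_word_gt0 w : 0 < (aff_word w).1.
Proof.
elim: w => //= -[[i|] b] w IHw /=; rewrite mulr_gt0 //.
by case: b; rewrite ?invr_gt0 ltr0n Gamma_exp_gt0.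
Qed.

End AffineAction.

Local Notation gen := (pgen (@Gamma_rel n)).
Local Notation a := (gen None : Gamma n).
Local Notation t := (fun i => gen (Some i) : Gamma n).
Local Open Scope group_scope.

(** Positive words in the t_i are kept as sequences: their product in Gamma_n
    depends only on the multiset of letters, which factorization recovers from
    the integer [qprod s]. *)
Definition tprod (s : seq 'I_(Gamma_rank n)) : Gamma n := \prod_(i <- s) t i.

Definition qprod (s : seq 'I_(Gamma_rank n)) : nat := (\prod_(i <- s) Gamma_exp i)%N.

Lemma pwordE u v : pword (@Gamma_rel n) (u ++ v) =
  (pword (@Gamma_rel n) u : Gamma n) * pword (@Gamma_rel n) v.
Proof. exact: pwordM. Qed.

Lemma gen_inv x : pword (@Gamma_rel n) [:: (x, true)] = (gen x : Gamma n)^-1.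
Proof. exact: (pwordV (@Gamma_rel n) [:: (x, false)]). Qed.

Lemma t_comm i j : commute (t i) (t j).
Proof.
have [->|ij] := eqVneq i j; first by [].
rewrite /commute -!pwordE; apply/pwordP/WordRel; exact: Gamma_comm.
Qed.

Lemma pword_nseq k : pword (@Gamma_rel n) (nseq k (None, false)) = a ^+ k :> Gamma n.
Proof. by elim: k => // k IHk; rewrite expgS -IHk -pwordE. Qed.

Lemma t_a i k : t i * a ^+ k = a ^+ (k * Gamma_exp i) * t i.
Proof.
have ta : t i * a * (t i)^-1 = a ^+ Gamma_exp i.
  rewrite -pword_nseq -gen_inv -(pwordE [:: _] [:: _]) -pwordE.
  apply/pwordP/WordRel; exact: (Gamma_conj i).
have ta' : t i * a = a ^+ Gamma_exp i * t i by rewrite -ta mulgVK.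
elim: k => [|k IHk]; first by rewrite mulg1 mul1g.
by rewrite expgSr mulgA IHk -mulgA ta' mulgA -expgnDr mulSn addnC.
Qed.

Lemma tprod_comm s i : commute (tprod s) (t i).
Proof. by apply/commute_sym/commute_prod => j _; apply: t_comm. Qed.

Lemma tprod_a s k : tprod s * a ^+ k = a ^+ (k * qprod s) * tprod s.
Proof.
rewrite /tprod /qprod.
elim: s k => [|i s IHs] k; first by rewrite !big_nil mul1g mulg1 muln1.
by rewrite !big_cons -mulgA IHs mulgA t_a -mulgA -mulnA (mulnC (qprod s)).
Qed.

Lemma tprod_perm s s' : perm_eq s s' -> tprod s = tprod s'.
Proof.
move=> ss'; pose P u := tprod s = tprod u.
apply: (catCA_perm_ind (P := P) _ ss') => // s1 s2 s3; rewrite /P => ->.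
rewrite /tprod !big_cat /= !mulgA; congr (_ * _).
by apply: commute_prod => i _; apply/tprod_comm.
Qed.

Lemma logn_qprod s (i : 'I_(Gamma_rank n)) :
  logn (nth 0 (primes n) i) (qprod s)
    = (count_mem i s * logn (nth 0 (primes n) i) n)%N.
Proof.
have pr (j : 'I_(Gamma_rank n)) : prime (nth 0 (primes n) j).
  by have := mem_nth 0 (ltn_ord j); rewrite mem_primes => /and3P[].
rewrite /qprod; elim: s => [|j s IHs]; first by rewrite big_nil logn1.
rewrite big_cons lognM ?Gamma_exp_gt0 ?prodn_gt0 //; last first.
  by move=> k; apply: Gamma_exp_gt0.
rewrite IHs /= mulnDl /Gamma_exp lognX (logn_prime _ (pr j)).
have -> : (nth 0 (primes n) i == nth 0 (primes n) j) = (i == j).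
  by rewrite nth_uniq ?primes_uniq // -val_eqE.
rewrite eq_sym; congr (_ + _)%N; have [->|_] := eqVneq j i.
  by rewrite muln1 mul1n.
by rewrite muln0 mul0n.
Qed.

(** The numbers [Gamma_exp i] are powers of distinct primes, so the multiplicity
    of [i] in [s] can be read off the [p_i]-adic valuation of [qprod s]. *)
Lemma qprod_inj s s' : qprod s = qprod s' -> tprod s = tprod s'.
Proof.
move=> e; apply: tprod_perm; apply/allP => i _ /=; apply/eqP.
have := congr1 (logn (nth 0 (primes n) i)) e; rewrite !logn_qprod => /eqP.
rewrite eqn_pmul2r => [/eqP //|].
by rewrite logn_gt0 mem_nth.
Qed.

(** The set of the elements of this form is stable under left multiplication by the
    generators and their inverses: [t i] passes through [(tprod s)^-1], by
    commutation, and through powers of [a], which it raises to the power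
    [Gamma_exp i]; while [a] passes through [(tprod s)^-1] at the cost of being
    raised to the power [qprod s].  The integer power of [a] is a quotient of two
    natural powers. *)
Lemma Gamma_normal_form (g : Gamma n) : exists s k l s',
  g = (tprod s)^-1 * (a ^+ k * a ^- l) * tprod s'.
Proof.
rewrite -[g]pword_repr; elim: (repr g) => [|[x b] w [s [k [l [s' IHw]]]]].
  by exists [::], 0, 0, [::]; rewrite /tprod !big_nil !gsimp.
rewrite -cat1s pwordE {}IHw.
case: x => [i|].
  case: b.
    exists (rcons s i), k, l, s'.
    by rewrite gen_inv /tprod -cats1 big_cat big_seq1 invgM !mulgA.
  exists s, (k * Gamma_exp i)%N, (l * Gamma_exp i)%N, (i :: s').
  have -> : tprod (i :: s') = t i * tprod s' by rewrite /tprod big_cons.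
  rewrite !mulgA; congr (_ * _).
  rewrite (commuteV (commute_sym (tprod_comm s i))) -!mulgA; congr (_ * _).
  rewrite mulgA t_a -!mulgA; congr (_ * _).
  apply: (@mulgI _ (a ^+ (l * Gamma_exp i))); rewrite mulgA -t_a mulVKg.
  by rewrite -mulgA mulgV mulg1.
have aV : a * (tprod s)^-1 = (tprod s)^-1 * a ^+ qprod s.
  apply: (@mulgI _ (tprod s)); rewrite mulVKg mulgA -{1}(expg1 a) tprod_a.
  by rewrite mul1n mulgK.
case: b.
  exists s, k, (qprod s + l)%N, s'.
  rewrite gen_inv !mulgA; congr (_ * _).
  have aV' : a^-1 * (tprod s)^-1 = (tprod s)^-1 * a ^- qprod s.
    by apply: (@mulgI _ a); rewrite mulVKg mulgA aV mulgK.
  rewrite aV' -!mulgA; congr (_ * _).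
  rewrite addnC expgnDr invgM !mulgA; congr (_ * _).
  apply/commute_sym/commuteV/commuteX2; exact: commute_refl.
exists s, (qprod s + k)%N, l, s'.
by rewrite !mulgA aV -!mulgA expgnDr !mulgA.
Qed.

Section Faithful.
Local Open Scope ring_scope.

Definition Gamma_scale (g : Gamma n) : rat := (aff_word (repr g)).1.
Definition Gamma_shift (g : Gamma n) : rat := (aff_word (repr g)).2.

Lemma aff_expg (g : Gamma n) k : Gamma_scale g = 1 ->
  aff_word (repr (g ^+ k)%g) = (1, k%:R * Gamma_shift g).
Proof.
move=> g1; elim: k => [|k IHk]; first by rewrite aff_repr mul0r.
rewrite expgS aff_reprM IHk /aff_comp -/(Gamma_scale g) g1 -/(Gamma_shift g) /=.
by congr (_, _); rewrite -?natr1; ring.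
Qed.

Lemma aff_tprod s : aff_word (repr (tprod s)) = ((qprod s)%:R, 0).
Proof.
rewrite /tprod /qprod; elim: s => [|i s IHs]; first by rewrite !big_nil aff_repr.
rewrite !big_cons aff_reprM IHs aff_repr /aff_comp /= natrM.
by congr (_, _); ring.
Qed.

(** Comparing the actions of both sides of [tprod s * g = a ^+ k * a ^- l * tprod s']
    gives [qprod s = qprod s'] and [k = l] when [g] acts trivially. *)
Lemma Gamma_faithful (g : Gamma n) :
  Gamma_scale g = 1 -> Gamma_shift g = 0 -> g = 1%g.
Proof.
have [s [k [l [s' gE]]]] := Gamma_normal_form g => g1 g0.
have eg : (tprod s * g)%g = (a ^+ k * a^-1 ^+ l * tprod s')%g.
  by rewrite gE -!mulgA mulVKg expVgn.
have [a1 aV1] : aff_word (repr a) = (1, 1) /\ aff_word (repr a^-1%g) = (1, -1).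
  by rewrite -gen_inv !aff_repr /= /aff_comp /= expr0 expr1 !mul1r !addr0.
have := congr1 (fun x => aff_word (repr x)) eg.
rewrite !aff_reprM !aff_expg ?aff_tprod /Gamma_scale /Gamma_shift ?a1 ?aV1 //.
rewrite /aff_comp /= -/(Gamma_scale g) -/(Gamma_shift g) g1 g0.
rewrite !mul1r !mulr1 !mulr0 !addr0 => -[/eqP qq /esym/eqP].
rewrite mulrN1 subr_eq0 eqr_nat => /eqP kl; move: qq; rewrite eqr_nat => /eqP qq.
by rewrite gE kl mulgV mulg1 (qprod_inj qq) mulVg.
Qed.

Lemma Gamma_affine_rep : (2 <= n)%N -> inhabited (affine_rep (Gamma n)).
Proof.
move=> n_ge2; have [i] : exists i : 'I_(Gamma_rank n), true.
  suff r0 : (0 < Gamma_rank n)%N by exists (Ordinal r0).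
  by rewrite lt0n size_eq0 primes_eq0 -leqNgt.
have scale_i : Gamma_scale (t i) = (Gamma_exp i)%:R.
  by rewrite /Gamma_scale aff_repr /= mulr1.
constructor; apply: (@AffineRep (Gamma n) Gamma_scale Gamma_shift _ _ _ _ a _ _ (t i)).
- by move=> g h; rewrite /Gamma_scale aff_reprM.
- by move=> g h; rewrite /Gamma_shift aff_reprM.
- by move=> g; apply: aff_word_gt0.
- exact: Gamma_faithful.
- by rewrite /Gamma_scale aff_repr.
- by rewrite /Gamma_shift aff_repr.
- rewrite scale_i (eqr_nat _ _ 1) neq_ltn ltnS; apply/orP; right.
  have pi : nth 0%N (primes n) i \in primes n by rewrite mem_nth.
  by rewrite -{1}(expn0 (nth 0%N (primes n) i)) ltn_exp2l ?logn_gt0 // prime_gt1 //;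
    move: pi; rewrite mem_primes => /and3P[].
Qed.

End Faithful.

End GammaRep.

(** * Automorphisms of a product of affine groups *)

Section Product.
Local Open Scope ring_scope.
Variables (m : nat) (G : 'I_m -> groupType) (r : forall i, affine_rep (G i)).
Local Notation P := (prodgroup G).
Implicit Types (g h x y : P) (i j : 'I_m).

(** The subgroup of these elements is N in the outline above: a torsion-free abelian
    group that [shifts] embeds in [rat^m]. *)
Definition pure g : Prop := forall i, scale (r i) (g i) = 1.

Definition shifts g : 'rV[rat]_m := \row_i shift (r i) (g i).

(** The determinant of the action of [g] by conjugation on the pure elements. *)
Definition total_scale g : rat := \prod_i scale (r i) (g i).

Definition single i (x : G i) : P := dfwith (fun j => 1%g : G j) x.

Lemma total_scaleM g h : total_scale (g * h)%g = total_scale g * total_scale h.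
Proof.
by rewrite /total_scale -big_split; apply: eq_bigr => i _; apply: scaleM.
Qed.

Lemma total_scale_gt0 g : 0 < total_scale g.
Proof. by apply: prodr_gt0 => i _; apply: scale_gt0. Qed.

Lemma total_scaleV g : total_scale g^-1%g = (total_scale g)^-1.
Proof.
by rewrite /total_scale -prodfV; apply: eq_bigr => i _; apply: scaleV.
Qed.

Lemma total_scaleX g k : total_scale (g ^+ k)%g = total_scale g ^+ k.
Proof.
elim: k => [|k IHk]; last by rewrite expgS total_scaleM IHk exprS.
by rewrite /total_scale big1 // => i _; apply: scale1.
Qed.

Lemma single_in i (x : G i) : single x i = x.
Proof. exact: dfwith_in. Qed.

Lemma single_out i (x : G i) j : i != j -> single x j = 1%g.
Proof. exact: dfwith_out. Qed.

Lemma pure_single i (x : G i) : scale (r i) x = 1 -> pure (single x).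
Proof.
move=> x1 j; have [<-|ij] := eqVneq i j; first by rewrite single_in.
by rewrite single_out // scale1.
Qed.

Lemma total_scale_single i (x : G i) : total_scale (single x) = scale (r i) x.
Proof.
rewrite /total_scale (bigD1 i) //= single_in big1 ?mulr1 // => j ji.
by rewrite single_out 1?eq_sym // scale1.
Qed.

Lemma shifts_single i (x : G i) : shifts (single x) = shift (r i) x *: delta_mx 0 i.
Proof.
apply/rowP => j; rewrite !mxE /=; have [->|ji] := eqVneq j i.
  by rewrite single_in mulr1.
by rewrite single_out 1?eq_sym // shift1 mulr0.
Qed.

Lemma pureM g h : pure g -> pure h -> pure (g * h)%g.
Proof. by move=> g1 h1 i; rewrite scaleM g1 h1 mulr1. Qed.

Lemma pureV g : pure g -> pure g^-1%g.
Proof. by move=> g1 i; rewrite scaleV g1 invr1. Qed.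

Lemma pure1 : pure 1%g.
Proof. by move=> i; apply: scale1. Qed.

Lemma pureX g k : pure g -> pure (g ^+ k)%g.
Proof.
by move=> g1; elim: k => [|k IHk]; [apply: pure1|rewrite expgS; apply: pureM].
Qed.

Lemma pure_conj g h : pure h -> pure (g * h * g^-1)%g.
Proof. by move=> h1 i; rewrite !scaleM scaleV h1 mulr1 divff ?scale_neq0. Qed.

Lemma shifts1 : shifts 1%g = 0.
Proof. by apply/rowP => i; rewrite !mxE shift1. Qed.

Lemma shiftsM g h : pure g -> shifts (g * h)%g = shifts g + shifts h.
Proof. by move=> g1; apply/rowP => i; rewrite !mxE shiftM g1 mul1r. Qed.

Lemma shiftsV g : pure g -> shifts g^-1%g = - shifts g.
Proof. by move=> g1; apply/rowP => i; rewrite !mxE shiftV g1 invr1 mul1r. Qed.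

Lemma shiftsX g k : pure g -> shifts (g ^+ k)%g = k%:R *: shifts g.
Proof.
move=> g1; elim: k => [|k IHk]; first by rewrite expg0 shifts1 scale0r.
by rewrite expgS shiftsM // IHk mulrS scalerDl scale1r.
Qed.

Lemma shifts_inj g h : pure g -> pure h -> shifts g = shifts h -> g = h.
Proof.
move=> g1 h1 /rowP e; apply: functional_extensionality_dep => i.
by apply: (@rep_inj _ (r i)); rewrite ?g1 ?h1 //; have := e i; rewrite !mxE.
Qed.

(** A description of the pure elements by the group law alone, hence one that
    automorphisms preserve.  Pure elements form a normal abelian subgroup; in the
    other direction, conjugating by a translation of the [i]-th factor detects a
    scale different from 1 at [i]. *)
Lemma pureP g : pure g <-> forall h, commute g (h * g * h^-1)%g.
Proof.
split=> [g1 h|cg i].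
  have gh1 := pure_conj h g1.
  apply: shifts_inj; try exact: pureM.
  by rewrite (shiftsM _ g1) (shiftsM _ gh1) addrC.
apply: (@commute_conj_translation _ (r i)).
pose h := single (translation (r i)).
have : commute (g i) (h i * g i * (h i)^-1)%g := congr1 (@^~ i) (cg h).
by rewrite /h single_in.
Qed.

Lemma shifts_prod (s : seq 'I_m) (F : 'I_m -> P) : (forall i, pure (F i)) ->
  pure (\prod_(i <- s) F i)%g /\
  shifts (\prod_(i <- s) F i)%g = \sum_(i <- s) shifts (F i).
Proof.
move=> F1; elim: s => [|i s [s1 IHs]].
  by rewrite !big_nil shifts1; split=> //; apply: pure1.
by rewrite !big_cons shiftsM // IHs; split=> //; apply: pureM.
Qed.

Lemma pure_decomposition x : pure x -> x = (\prod_i single (x i))%g.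
Proof.
move=> x1; have [|s1 sE] := @shifts_prod (index_enum 'I_m) (fun i => single (x i)).
  by move=> i; apply: pure_single.
apply: shifts_inj => //; rewrite sE [LHS]row_sum_delta.
by apply: eq_bigr => i _; rewrite shifts_single mxE.
Qed.

Section Automorphism.
Variables (phi : UMagmaMorphism.type P P) (psi : P -> P).
Hypotheses (phiK : cancel phi psi) (psiK : cancel psi phi).

Lemma pure_aut x : pure x -> pure (phi x).
Proof.
move=> /pureP cx; apply/pureP => h; rewrite -(psiK h).
rewrite -(@gmulfV _ _ phi) -!(@gmulfM _ _ phi).
exact/gmulf_commute.
Qed.

Lemma pure_aut_inv x : pure (phi x) -> pure x.
Proof.
move=> /pureP cx; apply/pureP => h.
have := cx (phi h); rewrite -(@gmulfV _ _ phi) /commute -!(@gmulfM _ _ phi).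
exact: (can_inj phiK).
Qed.

(** Automorphisms are additive on pure elements, hence commute with rational scalars:
    for [c = s / t] the hypothesis says [y ^+ t = x ^+ s], an equation that
    [phi] transports. *)
Lemma shifts_aut_scale x y c : pure x -> pure y ->
  shifts y = c *: shifts x -> shifts (phi y) = c *: shifts (phi x).
Proof.
(* a negative ratio is absorbed by inverting x *)
wlog c0 : x c / 0 <= c => [IH x1 y1 e|x1 y1 e].
  have [c0|c0] := leP 0 c; first exact: IH.
  rewrite (IH x^-1%g (- c)) ?oppr_ge0 ?(ltW c0) //; first last.
  - by rewrite shiftsV // scalerN scaleNr opprK.
  - exact: pureV.
  by rewrite gmulfV shiftsV ?scalerN ?scaleNr ?opprK //; apply: pure_aut.
pose s := `|numq c|%N; pose t := `|denq c|%N.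
have t0 : t%:R != 0 :> rat by rewrite pnatr_eq0 absz_eq0 denq_neq0.
have cE : t%:R * c = s%:R.
  rewrite -{1}[c]divq_num_den mulrCA /s /t !natr_absz ?ger0_norm ?numq_ge0 ?denq_ge0 //.
  by rewrite divff ?mulr1 // intr_eq0 denq_neq0.
have yx : (y ^+ t = x ^+ s)%g.
  apply: shifts_inj; try exact: pureX.
  by rewrite !shiftsX // e scalerA cE.
apply: (scalerI t0); rewrite scalerA cE -!shiftsX; try exact: pure_aut.
by rewrite -!(@gmulfXn _ _ phi) yx.
Qed.

Definition unit_single i : P := single (translation (r i)).

(** The matrix of [phi] on the pure elements, from the basis [unit_single] of their
    rational span to the standard basis of [rat^m]. *)
Definition aut_mx : 'M[rat]_m := \matrix_i shifts (phi (unit_single i)).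

Definition pure_coord x : 'rV[rat]_m :=
  \row_i (shift (r i) (x i) / shift (r i) (translation (r i))).

Lemma pure_unit_single i : pure (unit_single i).
Proof. exact/pure_single/scale_translation. Qed.

Lemma shifts_aut x : pure x -> shifts (phi x) = pure_coord x *m aut_mx.
Proof.
move=> x1; rewrite {1}(pure_decomposition x1) gmulf_prod.
have sx1 i : pure (single (x i)) by apply: pure_single.
have [//|_ ->] := @shifts_prod (index_enum 'I_m) (fun i => phi (single (x i))).
  by move=> i; apply: pure_aut.
rewrite mulmx_sum_row; apply: eq_bigr => i _; rewrite rowK mxE.
apply: shifts_aut_scale => //; first exact: pure_unit_single.
by rewrite !shifts_single scalerA divfK // shift_translation.
Qed.

(** The rows of the coordinates of the preimages of the basis form an inverse of
    [aut_mx], up to the diagonal matrix of the shifts of the basis. *)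
Lemma aut_mx_unit : \det aut_mx != 0.
Proof.
pose C := \matrix_i pure_coord (psi (unit_single i)).
pose d : 'rV[rat]_m := \row_i shift (r i) (translation (r i)).
have CB : C *m aut_mx = diag_mx d.
  apply/row_matrixP => i; rewrite row_mul rowK -shifts_aut ?psiK; last first.
    by apply: pure_aut_inv; rewrite psiK; apply: pure_unit_single.
  by rewrite shifts_single row_diag_mx mxE.
have: \det (diag_mx d) != 0.
  rewrite det_diag; apply/prodf_neq0 => i _; rewrite mxE; exact: shift_translation.
by rewrite -CB det_mulmx mulf_eq0 negb_or => /andP[].
Qed.

(** Both sides are determinants of conjugation actions on the pure elements, and
    the matrix of [phi] conjugates one action into the other. *)
Lemma total_scale_aut g : total_scale (phi g) = total_scale g.
Proof.
pose D h : 'M[rat]_m := diag_mx (\row_i scale (r i) (h i)).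
have detD h : \det (D h) = total_scale h.
  by rewrite det_diag; apply: eq_bigr => i _; rewrite mxE.
have shifts_conj h x : pure x -> shifts (h * x * h^-1)%g = shifts x *m D h.
  move=> x1; apply/rowP => i; rewrite mul_mx_diag !mxE mulrC.
  exact: shift_conj.
have BD : aut_mx *m D (phi g) = D g *m aut_mx.
  apply/row_matrixP => i; rewrite !row_mul rowK row_diag_mx mxE.
  have e1 := pure_unit_single i.
  rewrite -shifts_conj; last exact: pure_aut.
  rewrite -scalemxAl -rowE rowK -(@gmulfV _ _ phi) -!(@gmulfM _ _ phi).
  apply: shifts_aut_scale => //; first exact: pure_conj.
  rewrite shifts_conj // shifts_single -scalemxAl -rowE row_diag_mx mxE.
  by rewrite !scalerA mulrC.
apply: (mulfI aut_mx_unit); rewrite -!detD -!det_mulmx BD.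
by rewrite det_mulmx mulrC -det_mulmx.
Qed.

End Automorphism.

Lemma Rinfty_product : (0 < m)%N -> Rinfty P.
Proof.
move=> m0 phi0 [psi phiK psiK]; pose i := Ordinal m0.
have phi0_1 : phi0 1%g = 1%g.
  by apply: (@mulgI _ (phi0 1%g)); rewrite -gmulfM !mulg1.
(* a multiplicative map between groups preserves 1, so it is a monoid morphism *)
pose phiM := isUMagmaMorphism.Build P P phi0 (phi0_1, @gmulfM _ _ phi0).
pose phi : UMagmaMorphism.type P P := HB.pack (phi0 : P -> P) phiM.
rewrite -[Multiplicative.sort phi0]/(phi : P -> P).
pose g := single (dilation (r i)).
apply: (@infinite_of_seq _ _ (fun k => twisted_class phi (g ^+ k)%g)); last first.
  by move=> k; exists (g ^+ k)%g.
move=> j k e; have : twisted_class phi (g ^+ k)%g (g ^+ j)%g.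
  by rewrite -e; exists 1%g; rewrite gmulf1 invg1 mul1g mulg1.
case=> z /(congr1 total_scale); rewrite !total_scaleM total_scaleV.
rewrite (total_scale_aut (phi := phi) phiK psiK) mulrAC divff ?mul1r; last first.
  by rewrite lt0r_neq0 // total_scale_gt0.
rewrite !total_scaleX total_scale_single.
by move/(ieexprIn (scale_gt0 _ _) (scale_dilation _)) => ->.
Qed.

End Product.

(** * Products of finite index subgroups of the groups Gamma_n *)

Theorem corollary5p4 (m : nat) (G : 'I_m -> groupType) :
  1 <= m ->
  (forall i : 'I_m, exists2 n : nat, 2 <= n &
     isomorphic (G i) (Gamma n) \/
     exists2 H : groupClosed (Gamma n),
       finite_index H & isomorphic (G i) (subgroup H)) ->
  Rinfty (prodgroup G).
Proof.
move=> m_gt0 factorP.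
have repP i : inhabited (affine_rep (G i)).
  have [n n_ge2 GP] := factorP i; have [r] := Gamma_affine_rep n_ge2.
  case: GP => [/affine_rep_isomorphic /(_ r) //|[H finH isoH]].
  have [rH] := affine_rep_finite_index finH r.
  exact: affine_rep_isomorphic isoH rH.
pose r i : affine_rep (G i) :=
  projT1 (cid (let: inhabits s := repP i in ex_intro xpredT s isT)).
exact: Rinfty_product r m_gt0.
Qed.
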